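(* Let $K$ be a field, let $n\geq m\geq 3$ be integers, and let $G_1$ and $G_2$ be connected finite simple graphs with $V(G_1)=[m]$ and $V(G_2)=[n]$. Then the binomial edge ideal $J_{G_1,G_2}$ is unmixed if and only if $G_1$ is complete and for all subsets $T\subset[n]$ with the cut point property for $G_2$ one has $$(c(T)-1)(m-1)=|T|.$$
   Context: $[m]=\{1,\ldots,m\}$. $X=(x_{ij})$ is an $m\times n$ matrix of indeterminates, $K[X]$ the polynomial ring in its entries. For $e=\{i,j\}$ with $1\le i<j\le m$ and $f=\{k,l\}$ with $1\le k<l\le n$ put $p_{e,f}=x_{ik}x_{jl}-x_{il}x_{jk}$, and $J_{G_1,G_2}=(p_{e,f}: e\in E(G_1), f\in E(G_2))\subset K[X]$. An ideal is unmixed if all its associated primes have the same height. For a graph $G$ and $U\subset V(G)$, $G_U$ is the induced subgraph on $U$. A subset $S\subset V(G)$ has the cut point property for $G$ if for every $i\in S$ the number of connected components of $G_{(V(G)\setminus S)\cup\{i\}}$ is smaller than that of $G_{V(G)\setminus S}$ (so $\emptyset$ has the cut point property). For $T\subset[n]$, $c(T)$ denotes the number of connected components of $(G_2)_{[n]\setminus T}$. *)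

(* Defs.v *)
(* [mpoly] comes first because it rebinds names such as [symmetric]. *)
From mathcomp Require Import mpoly.
From mathcomp Require Import all_boot all_order all_algebra.
From mathcomp Require Import boolp classical_sets.

Set Implicit Arguments.
Unset Strict Implicit.
Unset Printing Implicit Defensive.

Import GRing.Theory.
Local Open Scope ring_scope.

Section Ideals.
Local Open Scope classical_set_scope.
Variable R : comNzRingType.
Implicit Types (A I P : set R) (h : nat).

Definition ideal_span A : set R :=
  [set f | exists2 s : seq (R * R),
     (forall u, u \in s -> A u.2) & f = \sum_(u <- s) u.1 * u.2].

(* [idealr_closed] requires 1 \notin P, so prime ideals are proper. *)
Definition prime_ideal P : Prop :=
  idealr_closed (mem P) /\ prime_idealr_closed (mem P).

(* Associated primes of the module R / I: the prime ideals (I : f). *)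
Definition associated_prime I P : Prop :=
  prime_ideal P /\ exists f, P = [set g | I (g * f)].

Definition prime_chain P h : Prop :=
  exists C : nat -> set R,
    [/\ forall i, (i <= h)%N -> prime_ideal (C i),
        forall i, (i < h)%N -> C i `<` C i.+1
      & C h = P].

Definition has_height P h : Prop :=
  prime_chain P h /\ forall k, prime_chain P k -> (k <= h)%N.

(* The common height is a natural number: this is no restriction when R is
   Noetherian, since then every prime ideal has finite height. *)
Definition unmixed I : Prop :=
  exists h, forall P, associated_prime I P -> has_height P h.

End Ideals.

Section Graphs.
Variables (V : finType) (E : rel V).

Definition connected_graph : Prop := forall x y, connect E x y.

Definition complete_graph : Prop := forall x y, x != y -> E x y.

Definition induced (U : {set V}) : rel V :=
  [rel x y | [&& x \in U, y \in U & E x y]].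

Definition ncomp_induced (U : {set V}) : nat := n_comp (induced U) U.

Definition cut_point_property (S : {set V}) : Prop :=
  forall i, i \in S -> (ncomp_induced (i |: ~: S) < ncomp_induced (~: S))%N.

End Graphs.

Section PairIdeal.
Local Open Scope classical_set_scope.
Variables (K : fieldType) (m n : nat).

(* K[X] for the generic m x n matrix X; the indeterminate x_ik is numbered by
   [mxvec_index i k]. *)
Definition x_ (i : 'I_m) (k : 'I_n) : {mpoly K[m * n]} := 'X_(mxvec_index i k).

Definition minor2 (i j : 'I_m) (k l : 'I_n) : {mpoly K[m * n]} :=
  x_ i k * x_ j l - x_ i l * x_ j k.

Definition binomial_edge_ideal (G1 : rel 'I_m) (G2 : rel 'I_n) :
    set {mpoly K[m * n]} :=
  ideal_span [set p | exists (i j : 'I_m) (k l : 'I_n),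
    [/\ (i < j)%N, (k < l)%N, G1 i j, G2 k l & p = minor2 i j k l]].

End PairIdeal.

Arguments binomial_edge_ideal K {m n} G1 G2.

(* Main.v *)
(* For a set T of columns, let P_T be the kernel of x_ik |-> s_(i, c(k)) t_k, where c(k) is the
   component of k in G_2 - T, and x_ik |-> 0 for k in T.  Substituting the dependent variables one
   at a time gives a chain of primes ending at P_T, and the free variables are algebraically
   independent modulo P_T, so P_T has height m|T| + (m-1)(n - |T| - c(T)).

   If T has the cut point property, then after inverting what lies outside P_T the 2-minors
   propagate along the components of G_2 - T, and every t in T joins two components, which forces
   the variables x_it into the localized ideal; hence P_T = J : f is associated to J.  This holds
   for every connected G_1, and also with rows and columns exchanged.  If G_1 is not complete, a
   minimal separating set S of rows would satisfy (c(S) - 1)(n - 1) = |S| <= m - 2, which n >= m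
   excludes.

   If G_1 is complete, two monomials with the same column degrees and the same row degrees on each
   component of the graph induced on the columns they involve are congruent modulo J.  Hence J is
   the intersection of all P_T, and its associated primes are the P_T for T with the cut point
   property. *)
Require Import Defs.
From mathcomp Require Import mpoly.
From mathcomp Require Import all_boot all_order all_algebra.
From mathcomp Require Import boolp classical_sets zify ring.

Set Implicit Arguments.
Unset Strict Implicit.
Unset Printing Implicit Defensive.

Import GRing.Theory.
Local Open Scope ring_scope.

(** * Ideals, generated ideals and prime ideals *)

Section Ideals.
Variable R : comNzRingType.
Implicit Types (I P Q : set R).

Definition is_ideal I : Prop :=
  I 0 /\ forall a u v, I u -> I v -> I (a * u + v).

Lemma prime_idealE P : prime_ideal P <->
  [/\ is_ideal P, ~ P 1 & forall u v, P (u * v) -> P u \/ P v].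
Proof.
split.
  case=> -[]; rewrite !inE => P0 P1 PD PM; split.
  - split=> // a u v Pu Pv.
    by have := PD a u v; rewrite !inE; apply.
  - by move=> /mem_set; rewrite (negbTE P1).
  - move=> u v Puv; have := PM u v; rewrite !inE => /(_ Puv).
    by case/orP; rewrite inE; [left|right].
case=> -[P0 PD] P1 PM; split; first split.
- by rewrite inE.
- by apply/negP; rewrite inE.
- by move=> a u v; rewrite !inE; apply: PD.
- move=> u v; rewrite !inE => /PM[] ?; apply/orP; [left|right]; by rewrite inE.
Qed.

Lemma ideal_add I u v : is_ideal I -> I u -> I v -> I (u + v).
Proof. by case=> _ ID Iu Iv; rewrite -[u]mul1r; apply: ID. Qed.

Lemma ideal_mull I a u : is_ideal I -> I u -> I (a * u).
Proof. by case=> I0 ID Iu; rewrite -[_ * _]addr0; apply: ID. Qed.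

Lemma ideal_mulr I a u : is_ideal I -> I u -> I (u * a).
Proof. by move=> Iid Iu; rewrite mulrC; apply: ideal_mull. Qed.

Lemma ideal_opp I u : is_ideal I -> I u -> I (- u).
Proof. by move=> Iid Iu; rewrite -mulN1r; apply: ideal_mull. Qed.

Lemma ideal_sub I u v : is_ideal I -> I u -> I v -> I (u - v).
Proof. by move=> Iid Iu Iv; apply: ideal_add => //; apply: ideal_opp. Qed.

Lemma ideal_sum I (J : eqType) (s : seq J) (p : pred J) (F : J -> R) :
  is_ideal I -> (forall j, j \in s -> p j -> I (F j)) -> I (\sum_(j <- s | p j) F j).
Proof.
move=> Iid IF; rewrite big_seq_cond; elim/big_rec: _ => [|j x /andP[js pj] Ix].
  by case: Iid.
by apply: ideal_add => //; apply: IF.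
Qed.

Lemma ideal_span_is_ideal (A : set R) : is_ideal (ideal_span A).
Proof.
split; first by exists [::]; rewrite ?big_nil.
move=> a u v [s As ->] [t At ->].
exists ([seq (a * w.1, w.2) | w <- s] ++ t).
  by move=> w; rewrite mem_cat => /orP[/mapP[w' /As ? ->]|/At].
rewrite big_cat big_map mulr_sumr; congr (_ + _).
by apply: eq_bigr => w _; rewrite mulrA.
Qed.

Lemma ideal_span_gen (A : set R) u : A u -> ideal_span A u.
Proof.
move=> Au; exists [:: (1, u)]; last by rewrite big_seq1 mul1r.
by move=> w; rewrite inE => /eqP ->.
Qed.

Lemma ideal_span_sub (A : set R) I :
  is_ideal I -> (forall u, A u -> I u) -> forall u, ideal_span A u -> I u.
Proof.
move=> Iid AI u [s As ->]; apply: ideal_sum => // w ws _.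
by apply: ideal_mull => //; apply/AI/As.
Qed.

Lemma prime_ideal_prod P (J : eqType) (s : seq J) (F : J -> R) :
  prime_ideal P -> P (\prod_(j <- s) F j) -> exists2 j, j \in s & P (F j).
Proof.
move=> /prime_idealE[_ P1 PM]; elim: s => [|j s IHs]; first by rewrite big_nil.
rewrite big_cons => /PM[Pj|/IHs[k ks Pk]]; first by exists j; rewrite ?inE ?eqxx.
by exists k => //; rewrite inE ks orbT.
Qed.

Lemma has_height_uniq P h k : has_height P h -> has_height P k -> h = k.
Proof.
by move=> [Ph hP] [Pk kP]; apply/eqP; rewrite eqn_leq kP // hP.
Qed.

End Ideals.

(** * Morphisms out of polynomial rings *)

Lemma rmorph_ker_prime (R : comNzRingType) (S : idomainType)
  (f : {rmorphism R -> S}) : prime_ideal [set u | f u = 0]%classic.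
Proof.
apply/prime_idealE; split.
- by split=> [|a u v] /=; rewrite ?rmorph0 // rmorphD rmorphM => -> ->; rewrite mulr0 addr0.
- by move=> /= /eqP; rewrite rmorph1 oner_eq0.
- by move=> u v /= /eqP; rewrite rmorphM mulf_eq0 => /orP[]/eqP; [left|right].
Qed.

Lemma mpoly_rmorph_ext (K : nzRingType) n (S : nzRingType)
    (f g : {rmorphism {mpoly K[n]} -> S}) :
  (forall c, f c%:MP = g c%:MP) -> (forall i, f 'X_i = g 'X_i) -> f =1 g.
Proof.
move=> fgC fgX p; rewrite [p]mpolyE !rmorph_sum; apply: eq_bigr => m _.
rewrite -mul_mpolyC !rmorphM fgC mpolyXE_id !rmorph_prod; congr (_ * _).
by apply: eq_bigr => i _; rewrite !rmorphXn fgX.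
Qed.

Notation msubst := (mmap (@mpolyC _ _)).

Lemma msubstXU (K : comNzRingType) n k (h : 'I_n -> {mpoly K[k]}) i : msubst h 'X_i = h i.
Proof. by rewrite mmapX mmap1U. Qed.

Lemma msubst_minor (K : comNzRingType) n k (h : 'I_n -> {mpoly K[k]}) a b c d :
  msubst h (a * b - c * d) = msubst h a * msubst h b - msubst h c * msubst h d.
Proof. by rewrite rmorphB; congr (_ - _); exact: rmorphM. Qed.

(** Congruence modulo [I] respects sums and products, so constants and variables decide. This
    replaces comparing two morphisms into the quotient by [I]. *)
Lemma rmorph_congr (K : nzRingType) n (S : comNzRingType) (I : set S)
    (f g : {rmorphism {mpoly K[n]} -> S}) : is_ideal I ->
  (forall c, f c%:MP = g c%:MP) -> (forall i, I (f 'X_i - g 'X_i)) ->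
  forall p, I (f p - g p).
Proof.
move=> Iid fgC fgX p.
have IM u v u' v' : I (u - u') -> I (v - v') -> I (u * v - u' * v').
  move=> Iu Iv; have -> : u * v - u' * v' = (u - u') * v + u' * (v - v').
    by rewrite mulrBl mulrBr addrA subrK.
  exact: (ideal_add Iid (ideal_mulr v Iid Iu) (ideal_mull u' Iid Iv)).
have I0 : I 0 by case: Iid.
rewrite [p]mpolyE !rmorph_sum -sumrB; apply: ideal_sum => // m _ _.
rewrite -mul_mpolyC !rmorphM fgC; apply: (IM); first by rewrite subrr.
rewrite mpolyXE_id !rmorph_prod; elim/big_ind2: _ => [||i _]; first by rewrite subrr.
- by move=> ? ? ? ?; apply: IM.
- rewrite !rmorphXn; elim: (m i) => [|k IHk]; first by rewrite !expr0 subrr.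
  by rewrite !exprS; apply: IM.
Qed.

(** * Algebraic independence modulo a prime and lengths of prime chains *)

Section AlgebraicIndependence.
Variables (K : fieldType) (N : nat).
Implicit Types (P Q : set {mpoly K[N]}).

Definition alg_indep P d (y : 'I_d -> {mpoly K[N]}) : Prop :=
  forall F : {mpoly K[d]}, P (msubst y F) -> F = 0.

(* In a relation F(f, y) in P, setting the first variable to 0 gives F(0, y) in Q because f is in
   Q; so F(0, y) vanishes identically, F is divisible by the first variable, and f cancels. *)
Lemma alg_indep_cons P Q d (y : 'I_d -> {mpoly K[N]}) f :
  prime_ideal P -> prime_ideal Q -> (P `<=` Q)%classic -> Q f -> ~ P f ->
  alg_indep Q y -> alg_indep P (fun i : 'I_d.+1 => oapp y f (unlift ord0 i)).
Proof.
move=> /prime_idealE[Pid _ PM] /prime_idealE[Qid _ _] PQ Qf Pf yQ F.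
set y' := fun i => _.
have [n] := ubnP (msize F); elim: n F => // n IHn F ltFn PF.
pose h (i : 'I_d.+1) : {mpoly K[d]} := oapp (fun j => 'X_j) 0 (unlift ord0 i).
pose F0 := msubst h F.
pose e (j : 'I_d) : {mpoly K[d.+1]} := 'X_(lift ord0 j).
pose I : set {mpoly K[d.+1]} := [set u | exists G, u = 'X_ord0 * G]%classic.
have Iid : is_ideal I.
  split; first by exists 0; rewrite mulr0.
  move=> a _ _ [G ->] [H ->]; exists (a * G + H).
  by rewrite mulrDr mulrCA.
(* Applying [h] and then [e] fixes every variable but the first, which goes to 0, so [F] changes by
   a multiple of that variable. *)
have [G FG] : I (F - msubst e F0).
  apply: (@rmorph_congr K d.+1 _ I idfun (msubst e \o msubst h)) => //=.
    by move=> c; rewrite !mmapC.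
  move=> i; rewrite msubstXU /h; case: unliftP => [j ->|->] /=.
    by rewrite msubstXU subrr; case: Iid.
  by rewrite rmorph0 subr0; exists 1; rewrite mulr1.
have eqF : F = 'X_ord0 * G + msubst e F0 by rewrite -FG subrK.
have yF : msubst y' F = f * msubst y' G + msubst y F0.
  rewrite {1}eqF rmorphD rmorphM /= msubstXU /y' unlift_none /=; congr (_ + _).
  apply: (@mpoly_rmorph_ext K _ _ (msubst y' \o msubst e) (msubst y)) => /=.
    by move=> c; rewrite !mmapC.
  by move=> i; rewrite !msubstXU /y' liftK.
have F00 : F0 = 0.
  apply: yQ; have -> : msubst y F0 = msubst y' F - f * msubst y' G.
    by rewrite yF addrC addKr.
  exact: (ideal_sub Qid (PQ _ PF) (ideal_mulr _ Qid Qf)).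
move: eqF yF; rewrite F00 !rmorph0 !addr0 => eqF yF.
have [G0|G0] := eqVneq G 0; first by rewrite eqF G0 mulr0.
rewrite eqF (IHn G) ?mulr0 //.
  move: ltFn; rewrite eqF msizeM ?msizeX ?mdeg1 //.
  by rewrite -msize_poly_eq0 msizeX.
by move: PF; rewrite yF => /PM[].
Qed.

(* The D^d monomials in y with exponents below D lie in the span of E^N monomials with E linear
   in D, so they are linearly dependent for D large when d > N. *)
Lemma alg_indep_leq P d (y : 'I_d -> {mpoly K[N]}) :
  is_ideal P -> alg_indep P y -> (d <= N)%N.
Proof.
move=> [P0 _] yP; rewrite leqNgt; apply/negP => ltNd.
pose B := (\max_(j < d) msize (y j))%N.
(* With exponents below [D] only monomials of degree below [E] occur, and [E <= D * (d * B.+1).+1].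
   Since [D] exceeds [(d * B.+1).+1 ^ N], this gives [E ^ N < D ^ N.+1 <= D ^ d]. *)
pose D := ((d * B.+1).+1 ^ N).+1.
pose E := (d * (D * B).+1).+1.
pose A := {ffun 'I_d -> 'I_D}; pose C := {ffun 'I_N -> 'I_E}.
pose ma (a : A) : 'X_{1..d} := [multinom (a i : nat) | i < d].
pose mc (c : C) : 'X_{1..N} := [multinom (c i : nat) | i < N].
pose M := \matrix_(i < #|A|, j < #|C|) (msubst y 'X_[ma (enum_val i)])@_(mc (enum_val j)).
have ltCA : (#|C| < #|A|)%N.
  rewrite !card_ffun !card_ord.
  have le1 : (E ^ N <= (D * (d * B.+1).+1) ^ N)%N.
    suff leE : (E <= D * (d * B.+1).+1)%N by case: (N) => // N'; rewrite leq_exp2r.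
    by rewrite /E /D; move: (_ ^ N)%N => q; nia.
  apply: leq_ltn_trans le1 _; rewrite expnMn.
  have le2 : (D ^ N.+1 <= D ^ d)%N by rewrite leq_pexp2l.
  apply: leq_trans le2; rewrite expnSr ltn_pmul2l ?expn_gt0 //.
have bound (a : A) m : m \in msupp (msubst y 'X_[ma a]) -> (mdeg m < E)%N.
  move=> /msize_mdeg_lt ltm; apply: leq_trans ltm _.
  rewrite mmapX /mmap1 /E.
  have sizeM (p q : {mpoly K[N]}) : (msize (p * q) <= msize p + msize q)%N.
    have [->|p0] := eqVneq p 0; first by rewrite mul0r msize0.
    have [->|q0] := eqVneq q 0; first by rewrite mulr0 msize0.
    by rewrite msizeM // leq_pred.
  have sizeX (p : {mpoly K[N]}) k b : (msize p <= b)%N -> (msize (p ^+ k) <= (k * b).+1)%N.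
    move=> pb; elim: k => [|k IHk]; first by rewrite expr0 msize1.
    rewrite exprS (leq_trans (sizeM _ _)) // mulSn -addnS.
    exact: leq_add.
  have main (s : seq 'I_d) : (msize (\prod_(i <- s) y i ^+ ma a i) <= (size s * (D * B).+1).+1)%N.
    elim: s => [|i s IHs]; first by rewrite big_nil msize1.
    rewrite big_cons; apply: leq_trans (sizeM _ _) _.
    have h : (msize (y i ^+ ma a i) <= (D * B).+1)%N.
      apply: leq_trans (sizeX _ _ B _) _.
        by rewrite /B; apply: (leq_bigmax i).
      by rewrite ltnS leq_mul2r mnmE ltnW ?orbT.
    by rewrite mulSn -addnS leq_add.
  have := main (index_enum 'I_d).
  by rewrite /index_enum -enumT size_enum_ord.
(* [M] has more rows than columns, so its rows are linearly dependent; [u] holds the coefficients of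
   the relation [F]. *)
have [u uM u0] : exists2 u : 'rV[K]_#|A|, u *m M = 0 & u != 0.
  have : kermx M != 0.
    by rewrite kermx_eq0 /row_free neq_ltn (leq_ltn_trans (rank_leq_col M)).
  case/rowV0Pn => u /sub_kermxP uM u0; by exists u.
pose F := \sum_(i < #|A|) u 0 i *: ('X_[ma (enum_val i)] : {mpoly K[d]}).
have F0 : msubst y F = 0.
  apply/mpolyP => m; rewrite mcoeff0.
  rewrite [msubst y F]raddf_sum raddf_sum /=.
  have yE i : (msubst y (u 0 i *: 'X_[ma (enum_val i)]))@_m =
      u 0 i * (msubst y 'X_[ma (enum_val i)])@_m.
    by rewrite mmapZ mcoeffCM.
  rewrite (eq_bigr _ (fun i _ => yE i)).
  (* A monomial of degree at least [E] need not have a column in [M], but it occurs in none of the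
     products. *)
  case: (ltnP (mdeg m) E) => ltm; last first.
    rewrite big1 // => i _; rewrite memN_msupp_eq0 ?mulr0 //.
    by apply: contraTN ltm => /bound; rewrite -ltnNge.
  have ltmi i : (m i < E)%N.
    by apply: leq_ltn_trans ltm; rewrite mdegE (bigD1 i) //= leq_addr.
  pose c : C := [ffun i => Ordinal (ltmi i)].
  have mcE : mc c = m by apply/mnmP => i; rewrite mnmE ffunE.
  have /rowP/(_ (enum_rank c)) := uM; rewrite !mxE => uM0; apply: etrans uM0.
  by apply: eq_bigr => i _; rewrite mxE enum_rankK mcE.
have /mpolyP FE := yP F (eq_ind_r P P0 F0).
case/eqP: u0; apply/rowP => i; rewrite mxE.
have := FE (ma (enum_val i)); rewrite mcoeff0 raddf_sum /= (bigD1 i) //= big1.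
  by rewrite mcoeffZ mcoeffX eqxx mulr1 addr0.
move=> j ji; rewrite mcoeffZ mcoeffX.
case: eqP => [eqm|]; last by rewrite mulr0.
case/eqP: ji; apply: enum_val_inj; apply/ffunP => k; apply: val_inj.
by have := congr1 (fun m : 'X_{1..d} => m k) eqm; rewrite !mnmE.
Qed.

(** Descending the chain from [P], each strict inclusion adds one independent element, so there are
    [k + d] of them modulo the bottom prime. *)
Lemma chain_length_leq P d (y : 'I_d -> {mpoly K[N]}) k :
  alg_indep P y -> prime_chain P k -> (k + d <= N)%N.
Proof.
move=> yP [C [Cprime Clt CP]].
have [z zC] : exists z : 'I_(k + d) -> {mpoly K[N]}, alg_indep (C 0%N) z.
  have : forall j, (j <= k)%N -> exists z : 'I_(j + d) -> {mpoly K[N]}, alg_indep (C (k - j)%N) z.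
    elim=> [|j IHj] ltjk; first by exists y; rewrite subn0 CP.
    have [z zC] := IHj (ltnW ltjk).
    have ltk : (k - j.+1 < k)%N by rewrite ltn_subrL /= (leq_ltn_trans _ ltjk).
    have := Clt _ ltk; rewrite subnSK // properEneq => -[neqC subC].
    have [f Cf Cf'] : exists2 f, C (k - j)%N f & ~ C (k - j.+1)%N f.
      apply: contrapT => nf; case/eqP: neqC; apply/seteqP; split=> // f Cf.
      by apply: contrapT => nCf; apply: nf; exists f.
    rewrite addSn; eexists; apply: alg_indep_cons zC => //; try exact: Cf; try exact: Cf'.
    - by apply: Cprime; rewrite leq_subr.
    - by apply: Cprime; rewrite leq_subr.
  by move/(_ k (leqnn k)); rewrite subnn.
apply: alg_indep_leq zC.
by have /prime_idealE[] := Cprime 0%N (leq0n k).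
Qed.

End AlgebraicIndependence.

(** * Toric primes and their heights *)

Section ToricPrimes.
Variables (K : fieldType) (N m n : nat).
Variables (v : 'I_m -> 'I_n -> 'I_N) (row : 'I_N -> 'I_m) (col : 'I_N -> 'I_n).
Hypotheses (vrow : forall i k, row (v i k) = i) (vcol : forall i k, col (v i k) = k).
Hypothesis (rowcolK : forall a, v (row a) (col a) = a).
Local Notation x i k := ('X_(v i k) : {mpoly K[N]}).

Definition toric_s (a : 'I_N) : {mpoly K[N + n]} := 'X_(lshift n a).
Definition toric_t (k : 'I_n) : {mpoly K[N + n]} := 'X_(rshift N k).

(** A class of columns is encoded by its representative [r k]: the variable s_(i, c(k)) is the one
    numbered [v i (r k)]. *)
Definition toric_img (T : {set 'I_n}) (r : 'I_n -> 'I_n) (a : 'I_N) :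
    {mpoly K[N + n]} :=
  if col a \in T then 0 else toric_s (v (row a) (r (col a))) * toric_t (col a).

Definition toric_ideal T r : set {mpoly K[N]} :=
  [set g | msubst (toric_img T r) g = 0]%classic.

Lemma toric_ideal_prime T r : prime_ideal (toric_ideal T r).
Proof. exact: rmorph_ker_prime. Qed.

Section Height.
Variables (T : {set 'I_n}) (r : 'I_n -> 'I_n) (i0 : 'I_m).
Hypotheses (rT : forall k, (r k \in T) = (k \in T)) (rr : forall k, r (r k) = r k).

(* Modulo the kernel, x_ik = x_(i, r k) x_(i0, k) / x_(i0, r k) for k outside T: the variables
   in the row i0 and in the columns k = r k determine the others. *)
Definition toric_dep : {set 'I_N} :=
  [set a | (col a \in T) || (row a != i0) && (r (col a) != col a)].

Let freeP i k : k \notin T -> (i == i0) || (r k == k) -> v i k \notin toric_dep.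
Proof.
move=> kT ik; rewrite inE vrow vcol (negbTE kT) /=.
by rewrite negb_and !negbK.
Qed.

Let free_root i k : k \notin T -> v i (r k) \notin toric_dep.
Proof. by move=> kT; rewrite freeP ?rT ?rr ?eqxx ?orbT. Qed.

(** Dependent variables in [A] already have their toric image, the others still go to an [s]
    variable of their own. As [A] grows, the kernels run through the chain. *)
Definition partial_img (A : seq 'I_N) (a : 'I_N) : {mpoly K[N + n]} :=
  if (a \in toric_dep) && (a \notin A) then toric_s a else toric_img T r a.

Let partial_free A i k : k \notin T -> (i == i0) || (r k == k) ->
  msubst (partial_img A) (x i k) = toric_s (v i (r k)) * toric_t k.
Proof.
move=> kT ik; rewrite msubstXU /partial_img (negbTE (freeP _ _)) //=.
by rewrite /toric_img vcol vrow (negbTE kT).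
Qed.

(** Replacing s_b by the toric image of [b] turns one map into the next; toric images are unchanged
    because their [s] variables lie outside [toric_dep]. *)
Let partial_sub A b : b \in toric_dep -> forall g,
  msubst (partial_img A) g = 0 -> msubst (partial_img (rcons A b)) g = 0.
Proof.
move=> bD g g0.
pose psi (j : 'I_(N + n)) : {mpoly K[N + n]} :=
  if j == lshift n b then toric_img T r b else 'X_j.
have psi_img a : msubst psi (toric_img T r a) = toric_img T r a.
  rewrite /toric_img; case: ifPn => aT; first by rewrite rmorph0.
  rewrite rmorphM /= !msubstXU /psi eq_rlshift (inj_eq (@lshift_inj _ _)).
  case: eqP => // vb; move: bD; rewrite -vb => bD.
  by case/negP: (free_root (row a) aT).
suff -> : msubst (partial_img (rcons A b)) g = msubst psi (msubst (partial_img A) g).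
  by rewrite g0 rmorph0.
apply: (@mpoly_rmorph_ext K _ _ (msubst _) (msubst psi \o msubst _)) => /=.
  by move=> c; rewrite !mmapC.
move=> a; rewrite !msubstXU /partial_img mem_rcons inE negb_or.
case: (boolP (a \in toric_dep)) => //= aD.
case: (boolP (a \in A)) => [aA|aA]; rewrite ?andbF ?andbT /= ?psi_img //.
rewrite msubstXU /psi (inj_eq (@lshift_inj _ _)).
by case: eqVneq => [->|].
Qed.

Let partial_strict A b : b \in toric_dep -> b \notin A -> exists g,
  msubst (partial_img A) g <> 0 /\ msubst (partial_img (rcons A b)) g = 0.
Proof.
move=> bD bA.
have Ab : msubst (partial_img A) 'X_b = toric_s b.
  by rewrite msubstXU /partial_img bD bA.
have Abb : msubst (partial_img (rcons A b)) 'X_b = toric_img T r b.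
  by rewrite msubstXU /partial_img mem_rcons inE eqxx /= andbF.
have [bT|bT] := boolP (col b \in T).
  exists 'X_b; rewrite Ab Abb /toric_img bT; split=> // /(congr1 (meval (fun=> 1))).
  by rewrite mevalXU meval0 => /eqP; rewrite oner_eq0.
pose i := row b; pose k := col b.
(* This minor expresses ['X_b] through free variables. It vanishes once [b] has its toric image;
   before that, s_b = 0 and all other variables 1 give the value -1. *)
exists ('X_b * x i0 (r k) - x i (r k) * x i0 k).
have rkT : r k \notin T by rewrite rT.
rewrite !msubst_minor Ab Abb.
rewrite !(partial_free _ rkT) ?rr ?eqxx ?orbT // !(partial_free _ bT) ?eqxx //.
split; last first.
  rewrite /toric_img (negbTE bT) -/i -/k; apply/eqP; rewrite subr_eq0; apply/eqP.
  by rewrite mulrACA [RHS]mulrACA; congr (_ * _); rewrite mulrC.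
move/(congr1 (meval (fun j => (j != lshift n b)%:R))).
rewrite meval0 mevalB !mevalM !mevalXU !eq_rlshift !(inj_eq (@lshift_inj _ _)).
have nb j : v j (r k) == b = false.
  by apply/eqP => vb; case/negP: (free_root j bT); rewrite vb.
by rewrite !nb eqxx !mul0r !mulr1 => /eqP; rewrite sub0r oppr_eq0 oner_eq0.
Qed.

Let full_img : partial_img (enum toric_dep) =1 toric_img T r.
Proof. by move=> a; rewrite /partial_img mem_enum andbN. Qed.

Let toric_chain : prime_chain (toric_ideal T r) #|toric_dep|.
Proof.
pose D := enum toric_dep.
have sD : size D = #|toric_dep| by rewrite /D -cardE.
exists (fun i => [set g | msubst (partial_img (take i D)) g = 0]%classic); split.
- by move=> i _; apply: rmorph_ker_prime.
- move=> i; rewrite -sD => ltiD.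
  have a0 : 'I_N by case: (D) ltiD => // a.
  have bD : nth a0 D i \in toric_dep by rewrite -mem_enum mem_nth.
  rewrite (take_nth a0 ltiD) properEneq; split; last first.
    by move=> g; apply: partial_sub.
  have [|g [g1 g2]] := @partial_strict (take i D) _ bD.
    have : uniq (take i.+1 D) by rewrite take_uniq ?enum_uniq.
    by rewrite (take_nth a0 ltiD) rcons_uniq => /andP[].
  by apply/eqP => eqC; apply: g1; move: g2; rewrite -/([set g | _ = 0]%classic g) -eqC.
- rewrite -sD take_size; apply: eq_set => g; congr (_ = _).
  apply: (@mpoly_rmorph_ext K _ _ (msubst _) (msubst _)) => [c|a] /=; first by rewrite !mmapC.
  by rewrite !msubstXU full_img.
Qed.

Let toric_free_indep : exists y : 'I_#|~: toric_dep| -> {mpoly K[N]},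
  alg_indep (toric_ideal T r) y.
Proof.
pose y (j : 'I_#|~: toric_dep|) : {mpoly K[N]} := 'X_(enum_val j).
exists y => F; rewrite /toric_ideal /= => F0.
pose F' := {fraction {mpoly K[N]}}.
pose tf : {rmorphism {mpoly K[N]} -> F'} := @tofrac _.
have tf0 i k : tf (x i k) != 0.
  rewrite tofrac_eq0; apply/eqP => /(congr1 (meval (fun=> 1))).
  by rewrite mevalXU meval0 => /eqP; rewrite oner_eq0.
(* [theta] undoes the toric map on free variables, with values in the fraction field: s_a goes to
   x_a and t_k to x_(i0, k) / x_(i0, r k). A relation between free variables modulo the kernel is
   thus a relation in K[X]. *)
pose h (j : 'I_(N + n)) : F' := match split j with
  | inl a => tf 'X_a
  | inr k => tf (x i0 k) / tf (x i0 (r k)) end.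
pose theta : {mpoly K[N + n]} -> F' := mmap (tf \o @mpolyC _ _) h.
have thetaX j : theta 'X_j = h j by rewrite /theta mmapX mmap1U.
have thetaM p q : theta (p * q) = theta p * theta q by exact: rmorphM.
have Fy : tf (msubst y F) = 0.
  transitivity (theta (msubst (toric_img T r) (msubst y F))); last first.
    by rewrite F0 /theta rmorph0.
  apply: (@mpoly_rmorph_ext K _ _ (tf \o msubst y)
     (mmap (tf \o @mpolyC _ _) h \o msubst _ \o msubst y)) => /=.
    by move=> c; rewrite !mmapC.
  move=> j; rewrite !msubstXU /y.
  have := enum_valP j; rewrite finset.in_setC; move: (enum_val j) => a /negP aD.
  have aT : col a \notin T by apply/negP => aT; apply: aD; rewrite inE aT.
  rewrite -/theta /toric_img (negbTE aT) thetaM !thetaX /h.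
  rewrite -/(unsplit (inl _)) -/(unsplit (inr _)) !unsplitK.
  have [ra|ra] := eqVneq (r (col a)) (col a).
    by rewrite ra rowcolK divff ?mulr1.
  have -> : row a = i0.
    by apply: contrapT => /eqP ia; apply: aD; rewrite inE ia ra orbT.
  rewrite mulrC divfK //.
  have <- : row a = i0.
    by apply: contrapT => /eqP ia; apply: aD; rewrite inE ia ra orbT.
  by rewrite rowcolK.
move/eqP: Fy; rewrite tofrac_eq0 => /eqP Fy.
(* [z] is a left inverse of [y]; dependent variables get the default 0. *)
pose z (a : 'I_N) : {mpoly K[#|~: toric_dep|]} :=
  if [pick j | enum_val j == a] is Some j then 'X_j else 0.
have <- : msubst z (msubst y F) = F.
  apply: (@mpoly_rmorph_ext K _ _ (msubst z \o msubst y) idfun) => /=.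
    by move=> c; rewrite !mmapC.
  move=> j; rewrite msubstXU /y msubstXU /z.
  by case: pickP => [l /eqP/enum_val_inj -> //|/(_ j)]; rewrite eqxx.
by rewrite Fy rmorph0.
Qed.

(** Dependent and free variables together number [N], so the bound from the free ones equals the
    length of the chain built from the dependent ones. *)
Lemma toric_ideal_height : has_height (toric_ideal T r) #|toric_dep|.
Proof.
split; first exact: toric_chain.
move=> k; have [y yP] := toric_free_indep.
move=> /(chain_length_leq yP); rewrite -[X in (_ <= X)%N](card_ord N).
by rewrite -(cardsC toric_dep) leq_add2r.
Qed.

(** Counted by columns: a column in [T] contributes [m] entries, one outside [T] with [r k != k] all
    but the entry in row [i0], any other none. *)
Lemma card_toric_dep :
  #|toric_dep| = (m * #|T| + m.-1 * #|[set k in ~: T | r k != k]|)%N.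
Proof.
rewrite -sum1_card (reindex (fun p : 'I_m * 'I_n => v p.1 p.2)) /=; last first.
  exists (fun a => (row a, col a)) => [[i k]|a] _ /=; by rewrite ?vrow ?vcol.
rewrite (eq_bigl (fun p => xpredT p.1 && (v p.1 p.2 \in toric_dep))) //.
rewrite -(pair_big_dep xpredT (fun i k => v i k \in toric_dep) (fun _ _ => 1%N)) /=.
rewrite (exchange_big_dep xpredT) //=.
have depE k : (\sum_(i < m | v i k \in toric_dep) 1 =
    m * (k \in T) + m.-1 * (k \in [set k in ~: T | r k != k]))%N.
  have -> : (\sum_(i < m | v i k \in toric_dep) 1 =
      #|[set i | (k \in T) || (i != i0) && (r k != k)]|)%N.
    by rewrite -sum1_card; apply: eq_bigl => i; rewrite !finset.inE vrow vcol.
  rewrite !finset.inE; case: (boolP (k \in T)) => kT /=.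
    rewrite muln0 muln1 addn0 -[RHS]card_ord -cardsT; apply: eq_card => i.
    by rewrite !finset.inE.
  rewrite muln0 add0n; case: (r k != k) => /=.
    rewrite muln1 -[m in RHS](card_ord m) -(cardC1 i0); apply: eq_card => i.
    by rewrite !finset.inE andbT.
  rewrite muln0; apply/eqP; rewrite cards_eq0; apply/eqP/setP => i.
  by rewrite !finset.inE andbF.
rewrite (eq_bigr _ (fun k _ => depE k)) big_split /= -!big_distrr /=.
by rewrite -!big_mkcond /= !sum1_card.
Qed.

End Height.
End ToricPrimes.

(** * Moves on monomials *)

Lemma sum_eq_exists_lt (J : finType) (P : pred J) (f g : J -> nat) j0 :
  (\sum_(j | P j) f j = \sum_(j | P j) g j)%N -> P j0 -> (g j0 < f j0)%N ->
  exists2 j, P j & (f j < g j)%N.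
Proof.
move=> eqfg Pj0 ltj0; apply: contrapT => noj.
have le j : P j -> (g j <= f j)%N.
  by move=> Pj; rewrite leqNgt; apply/negP => lt; apply: noj; exists j.
move/eqP: eqfg; rewrite (bigD1 j0) //= [X in _ == X](bigD1 j0) //=.
have : (\sum_(j | P j && (j != j0)) g j <= \sum_(j | P j && (j != j0)) f j)%N.
  by apply: leq_sum => j /andP[/le].
lia.
Qed.

Section Monomials.
Variables (K : fieldType) (N m n : nat).
Variables (v : 'I_m -> 'I_n -> 'I_N) (row : 'I_N -> 'I_m) (col : 'I_N -> 'I_n).
Hypotheses (vrow : forall i k, row (v i k) = i) (vcol : forall i k, col (v i k) = k).
Hypothesis (rowcolK : forall a, v (row a) (col a) = a).
Local Notation x i k := ('X_(v i k) : {mpoly K[N]}).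
Implicit Types (u w : 'X_{1..N}) (I : set {mpoly K[N]}).

Let v_eq i1 k1 i2 k2 : (v i1 k1 == v i2 k2) = (i1 == i2) && (k1 == k2).
Proof.
apply/eqP/andP => [eqv|[/eqP-> /eqP->] //].
by have := congr1 row eqv; have := congr1 col eqv; rewrite !vrow !vcol => -> ->.
Qed.

Definition col_deg u k : nat := (\sum_(a | col a == k) u a)%N.
Definition row_deg (r : 'I_n -> 'I_n) u i d : nat :=
  (\sum_(a | (row a == i) && (r (col a) == d)) u a)%N.
Definition col_supp u : {set 'I_n} := [set k | col_deg u k != 0%N].

Lemma col_degD u w k : col_deg (u + w)%MM k = (col_deg u k + col_deg w k)%N.
Proof. by rewrite -big_split; apply: eq_bigr => a _; rewrite mnmDE. Qed.

Lemma col_deg1 a k : col_deg U_(a)%MM k = (col a == k).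
Proof.
rewrite /col_deg big_mkcond (bigD1 a) //= mnm1E eqxx big1 ?addn0; last first.
  by move=> b ba; rewrite mnm1E [a == b]eq_sym (negbTE ba); case: ifP.
by case: ifP.
Qed.

Lemma row_degD r u w i d : row_deg r (u + w)%MM i d = (row_deg r u i d + row_deg r w i d)%N.
Proof. by rewrite -big_split; apply: eq_bigr => a _; rewrite mnmDE. Qed.

Lemma row_deg1 r a i d : row_deg r U_(a)%MM i d = (row a == i) && (r (col a) == d).
Proof.
rewrite /row_deg big_mkcond (bigD1 a) //= mnm1E eqxx big1 ?addn0; last first.
  by move=> b ba; rewrite mnm1E [a == b]eq_sym (negbTE ba); case: ifP.
by case: ifP.
Qed.

Lemma col_suppE u k : (k \in col_supp u) = [exists i, u (v i k) != 0%N].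
Proof.
rewrite finset.inE /col_deg sum_nat_eq0 negb_forall; apply/existsP/existsP.
  move=> [a]; rewrite negb_imply => /andP[/eqP <- ua].
  by exists (row a); rewrite rowcolK.
by move=> [i ui]; exists (v i k); rewrite vcol eqxx.
Qed.

Definition swap_closed I (c : 'I_n -> 'I_n) (W : {set 'I_n}) : Prop :=
  forall w i j k l, c k = c l -> col_supp (w + U_(v i k) + U_(v j l))%MM = W ->
    I ('X_[w + U_(v i k) + U_(v j l)] - 'X_[w + U_(v i l) + U_(v j k)]).

(* If u(i,k) exceeds u'(i,k), equal column degrees give a row j with u(j,k) < u'(j,k), and equal
   row degrees then give a column l of the same class with u(j,l) > u'(j,l).  Swapping the
   entries at (i,k) and (j,l) of u brings it closer to u'. *)
Lemma swap_closed_monomials I c W u u' : is_ideal I -> swap_closed I c W ->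
  col_supp u = W -> col_deg u =1 col_deg u' -> row_deg c u =2 row_deg c u' ->
  I ('X_[u] - 'X_[u']).
Proof.
move=> Iid Isw; have [D] := ubnP (\sum_a (u a - u' a))%N.
elim: D u => // D IHD u ltD uW equ erow.
have [->|neq] := eqVneq u u'; first by rewrite subrr; case: Iid.
have [a lta] : exists a, (u' a < u a)%N.
  apply: contrapT => noa; case/eqP: neq; apply/mnmP => a; apply: contrapT => /eqP neqa.
  case: (ltngtP (u a) (u' a)) neqa => // lta _; last by apply: noa; exists a.
  have [|b _ ltb] := sum_eq_exists_lt (esym (equ (col a))) _ lta; first exact: eqxx.
  by apply: noa; exists b.
have [b /eqP colb ltb] := sum_eq_exists_lt (equ (col a)) (eqxx (col a)) lta.
have [|d /andP[/eqP rowd /eqP cold] ltd] :=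
  sum_eq_exists_lt (esym (erow (row b) (c (col b)))) _ ltb; first by rewrite !eqxx.
pose i := row a; pose k := col a; pose j := row b; pose l := col d.
have va : a = v i k by rewrite rowcolK.
have vb : b = v j k by rewrite /k -colb rowcolK.
have vd : d = v j l by rewrite /j -rowd rowcolK.
have ab : a != b by apply: contraTneq lta => ->; rewrite -leqNgt ltnW.
have ad : d != b by apply: contraTneq ltd => ->; rewrite -leqNgt ltnW.
have ij : i != j by apply: contraNneq ab => ij; rewrite va vb ij.
have kl : k != l by apply: contraNneq ad => kl; rewrite vd vb kl.
have vE := v_eq.
pose w := (u - (U_(v i k) + U_(v j l)))%MM.
have uw : u = (w + U_(v i k) + U_(v j l))%MM.
  apply/mnmP => b'; rewrite !mnmDE mnmBE mnmDE !mnm1E.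
  have [<-|] := eqVneq (v i k) b'; have [e|] := eqVneq (v j l) _ => //=.
  - by move/eqP: e; rewrite vE eq_sym (negbTE ij).
  - by rewrite -va; lia.
  - by rewrite -e -vd; lia.
  - by lia.
pose u1 := (w + U_(v i l) + U_(v j k))%MM.
have ckl : c k = c l by rewrite /k -colb.
have I1 : I ('X_[u] - 'X_[u1]) by rewrite uw; apply: Isw => //; rewrite -uw.
have deg1 : col_deg u1 =1 col_deg u.
  by move=> k'; rewrite uw !col_degD !col_deg1 !vcol addnAC.
have rdeg1 : row_deg c u1 =2 row_deg c u.
  by move=> i' d'; rewrite uw !row_degD !row_deg1 !vcol !vrow ckl.
rewrite -(subrKA 'X_[u1]); apply: (ideal_add Iid I1); apply: IHD.
- rewrite ltnS in ltD; apply: leq_trans ltD.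
  (* The swap lowers the truncated difference by 1 at (i,k) and at (j,l), where [u] exceeds [u']. It
     costs nothing at (j,k), where [u] is below [u'], and at most 1 at (i,l). *)
  have main a' : ((u1 a' - u' a') + (a' == v i k) + (a' == v j l)
      <= (u a' - u' a') + (a' == v i l))%N.
    rewrite uw !mnmDE !mnm1E ![v _ _ == a']eq_sym.
    have := congr1 (fun u : 'X_{1..N} => u a') uw.
    rewrite !mnmDE !mnm1E ![v _ _ == a']eq_sym => uE.
    have [e|_] := eqVneq a' (v i k).
      move: uE lta; rewrite e !vE (negbTE ij) (negbTE kl) eqxx !andbF va => uE lta /=; lia.
    have [e|_] := eqVneq a' (v j l).
      move: uE ltd; rewrite e !vE ![j == i]eq_sym ![l == k]eq_sym (negbTE ij) (negbTE kl).
      rewrite eqxx !andbF -vd -?va => uE ltd /=; lia.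
    have [e|_] := eqVneq a' (v j k).
      move: uE ltb; rewrite e !vE ![j == i]eq_sym (negbTE ij) -vb => uE ltb /=; lia.
    by lia.
  have := @leq_sum _ (index_enum 'I_N) xpredT _ _ (fun a' _ => main a').
  rewrite !big_split /=.
  have one b' : (\sum_(a' < N) (a' == b') = 1)%N.
    by rewrite (bigD1 b') //= eqxx big1 // => a' /negbTE ->.
  by rewrite !one leq_add2r addn1.
- by rewrite -uW; apply/setP => k'; rewrite !finset.inE deg1.
- by move=> k'; rewrite deg1.
- by move=> i' d'; rewrite rdeg1.
Qed.

Lemma swap_closed_of_minors I c (W : {set 'I_n}) : is_ideal I ->
  (forall i j k l, c k = c l -> k \in W -> l \in W -> I (x i k * x j l - x i l * x j k)) ->
  swap_closed I c W.
Proof.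
move=> Iid Imin w i j k l ckl uW.
rewrite -!addmA !mpolyXD -mulrBr; apply: (ideal_mull _ Iid); apply: Imin => //.
- by rewrite -uW finset.inE !col_degD !col_deg1 !vcol eqxx; lia.
- by rewrite -uW finset.inE !col_degD !col_deg1 !vcol eqxx; lia.
Qed.

(** Induction on a path k, k1, ..., l inside [W]. If [k1] differs from [k] and [l], some x_(q, k1)
    divides ['X_[w]]. Swapping across the edge k - k1, along the rest of the path, and across the
    edge again has the desired effect and puts x_(q, k1) back. *)
Lemma swap_closed_of_edges I (G : rel 'I_n) (W : {set 'I_n}) : is_ideal I -> symmetric G ->
  (forall i j k l, G k l -> I (x i k * x j l - x i l * x j k)) ->
  swap_closed I (fingraph.root (induced G W)) W.
Proof.
move=> Iid Gsym Imin w i j k l.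
have Wsym : connect_sym (induced G W).
  by apply: sym_connect_sym => k1 k2; rewrite /induced /= Gsym andbCA.
move/eqP; rewrite root_connect // => /connectP[p].
elim: p k w i => [|k1 p IHp] k w i /=.
  by move=> _ -> _; rewrite subrr; case: Iid.
case/andP=> /and3P[kW k1W Gk] pp lp uW.
have edge w' i' j' : I ('X_[w' + U_(v i' k) + U_(v j' k1)] - 'X_[w' + U_(v i' k1) + U_(v j' k)]).
  rewrite -!addmA !mpolyXD -mulrBr; apply: (ideal_mull _ Iid).
  exact: Imin.
have [->|lk1] := eqVneq l k1; first exact: edge.
have [kk1|kk1] := eqVneq k k1.
  by move: uW; rewrite kk1; apply: IHp.
have : k1 \in col_supp w.
  move: k1W; rewrite -uW !finset.inE !col_degD !col_deg1 !vcol.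
  by rewrite (negbTE lk1) (negbTE kk1) !addn0.
rewrite col_suppE => /existsP[q wq].
pose w' := (w - U_(v q k1))%MM.
have ww' : w = (w' + U_(v q k1))%MM by rewrite submK // lep1mP.
have -> : (w + U_(v i k) + U_(v j l) = (w' + U_(v j l)) + U_(v i k) + U_(v q k1))%MM.
  by rewrite ww'; apply/mnmP => a; rewrite !mnmDE; lia.
have -> : (w + U_(v i l) + U_(v j k) = (w' + U_(v i l)) + U_(v q k1) + U_(v j k))%MM.
  by rewrite ww'; apply/mnmP => a; rewrite !mnmDE; lia.
have := edge (w' + U_(v j l))%MM i q.
set X1 := 'X_[_]; set X2 := 'X_[_] => I12.
have := edge (w' + U_(v i l))%MM q j.
set X3 := 'X_[_]; set X4 := 'X_[_] => I34.
have I23 : I (X2 - X3).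
  have := IHp k1 (w' + U_(v q k))%MM i pp lp.
  have -> : (w' + U_(v q k) + U_(v i k1) + U_(v j l) = w' + U_(v j l) + U_(v i k1) + U_(v q k))%MM.
    by apply/mnmP => a; rewrite !mnmDE; lia.
  have -> : (w' + U_(v q k) + U_(v i l) + U_(v j k1) = w' + U_(v i l) + U_(v q k) + U_(v j k1))%MM.
    by apply/mnmP => a; rewrite !mnmDE; lia.
  apply; rewrite -uW ww'; apply/setP => k'; rewrite !finset.inE !col_degD !col_deg1 !vcol.
  by congr (_ != _); lia.
rewrite -(subrKA X2); apply: (ideal_add Iid I12).
by rewrite -(subrKA X3); apply: (ideal_add Iid I23).
Qed.

Definition toric_mnm (r : 'I_n -> 'I_n) u : 'X_{1..N + n} :=
  (\sum_a (U_(lshift n (v (row a) (r (col a)))) + U_(rshift N (col a))) *+ u a)%MM.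

Lemma toric_mnm_col r u k : toric_mnm r u (rshift N k) = col_deg u k.
Proof.
rewrite /toric_mnm mnm_sumE /col_deg [RHS]big_mkcond; apply: eq_bigr => a _.
rewrite mulmnE mnmDE !mnm1E eq_lrshift (inj_eq (@rshift_inj _ _)).
by case: eqP; rewrite ?mul1n ?mul0n.
Qed.

Lemma toric_mnm_row r u i d : toric_mnm r u (lshift n (v i d)) = row_deg r u i d.
Proof.
rewrite /toric_mnm mnm_sumE /row_deg [RHS]big_mkcond; apply: eq_bigr => a _.
rewrite mulmnE mnmDE !mnm1E eq_rlshift (inj_eq (@lshift_inj _ _)) addn0.
rewrite v_eq; by case: (_ && _); rewrite ?mul1n ?mul0n.
Qed.

Lemma toric_msubstX T r u : msubst (toric_img K v row col T r) 'X_[u] =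
  if [disjoint T & col_supp u] then 'X_[toric_mnm r u] else 0.
Proof.
rewrite mmapX /mmap1; case: ifPn => [dis|/pred0Pn[k /andP[/= kT]]].
  rewrite /toric_mnm -mprodXnE; apply: eq_bigr => a _.
  have [aT|aT] := boolP (col a \in T); last first.
    by rewrite /toric_img (negbTE aT) /toric_s /toric_t -mpolyXD.
  have -> : u a = 0%N.
    apply: contraFeq (disjointFr dis aT) => ua.
    by rewrite col_suppE; apply/existsP; exists (row a); rewrite rowcolK.
  by rewrite !expr0.
rewrite col_suppE => /existsP[i ui].
rewrite (bigD1 (v i k)) //= {1}/toric_img vcol kT expr0n (negbTE ui).
by rewrite mul0r.
Qed.

(* The leading monomial u of g is removed by subtracting an element of I: if X^u is not in I, then
   the coefficient of the image of X^u in the image of g vanishes, so some other monomial u' of g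
   has the same image as u. *)
Lemma toric_inter_sub (Ts : {set 'I_n} -> Prop) (r : {set 'I_n} -> 'I_n -> 'I_n) I :
  is_ideal I ->
  (forall T, Ts T -> (I `<=` toric_ideal v row col T (r T))%classic) ->
  (forall u, I 'X_[u] \/ exists T, [/\ Ts T, [disjoint T & col_supp u] &
     forall u', [disjoint T & col_supp u'] -> toric_mnm (r T) u = toric_mnm (r T) u' ->
       I ('X_[u] - 'X_[u'])]) ->
  forall g, (forall T, Ts T -> toric_ideal v row col T (r T) g) -> I g.
Proof.
move=> Iid subI Iu g.
have [s] := ubnP (size (msupp g)); elim: s g => // s IHs g; rewrite ltnS => leg Tg.
have [->|g0] := eqVneq g 0; first by case: Iid.
pose u := mlead g; have ug : u \in msupp g by apply: mlead_supp.
(* By induction it suffices to subtract an element of [I] that cancels the leading term and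
   introduces no new monomial. *)
have red h : I h -> {subset msupp (g - h) <= rem u (msupp g)} -> I g.
  move=> Ih sub; rewrite -(subrK h g); apply: (ideal_add Iid _ Ih); apply: IHs.
    have := uniq_leq_size (msupp_uniq _) sub; rewrite size_rem //.
    move=> /leq_ltn_trans; apply; apply: leq_trans leg.
    by case: (msupp g) ug.
  move=> T TsT; have /prime_idealE[Tid _ _] := toric_ideal_prime K v row col T (r T).
  by apply: (ideal_sub Tid); [apply: Tg|apply: subI].
case: (Iu u) => [IX|[T [TsT uT Imon]]].
  apply: (red (g@_u *: 'X_[u])); first by rewrite -mul_mpolyC; apply: (ideal_mull _ Iid).
  move=> w; rewrite mem_rem_uniq ?msupp_uniq // inE !mcoeff_msupp mcoeffB mcoeffZ mcoeffX.
  by have [<-|_] := eqVneq u w; rewrite /= ?mulr1 ?subrr ?eqxx // mulr0 subr0.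
have [u' [u'g u'u u'T eqmon]] : exists u', [/\ u' \in msupp g, u' != u,
    [disjoint T & col_supp u'] & toric_mnm (r T) u = toric_mnm (r T) u'].
  apply: contrapT => no; have := Tg T TsT; rewrite /toric_ideal /=.
  set h := toric_img _ _ _ _ _ _.
  have -> : msubst h g = \sum_(w <- msupp g) g@_w *: msubst h 'X_[w].
    rewrite [in LHS](mpolyE g) raddf_sum; apply: eq_bigr => w _.
    by rewrite /= mmapZ mul_mpolyC.
  move/(congr1 (mcoeff (toric_mnm (r T) u))); rewrite mcoeff0 raddf_sum /=.
  rewrite (bigD1_seq u) ?msupp_uniq //= mcoeffZ toric_msubstX uT mcoeffX eqxx mulr1.
  rewrite big_seq_cond big1 ?addr0; first by apply/eqP; rewrite -mcoeff_msupp.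
  move=> u' /andP[u'g u'u]; rewrite mcoeffZ toric_msubstX.
  case: ifP => u'T; last by rewrite mcoeff0 mulr0.
  rewrite mcoeffX; case: eqP => [e|]; last by rewrite mulr0.
  by case: no; exists u'.
apply: (red (g@_u *: ('X_[u] - 'X_[u']))).
  by rewrite -mul_mpolyC; apply: (ideal_mull _ Iid); apply: Imon.
move=> w; rewrite mem_rem_uniq ?msupp_uniq // inE !mcoeff_msupp mcoeffB mcoeffZ mcoeffB !mcoeffX.
have [<-|uw] := eqVneq u w; first by rewrite (negbTE u'u) subr0 mulr1 subrr eqxx.
have [<-|_] := eqVneq u' w; first by rewrite -mcoeff_msupp u'g.
by rewrite subrr mulr0 subr0.
Qed.

End Monomials.

(** * Cut sets *)

Section InducedSubgraphs.
Variables (V : finType) (E : rel V).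
Hypothesis Esym : symmetric E.
Implicit Types (U S T : {set V}).
Local Notation rt U := (fingraph.root (induced E U)).

Lemma induced_connect_sym U : connect_sym (induced E U).
Proof.
apply: sym_connect_sym => x y; rewrite /induced /= Esym.
by rewrite andbCA.
Qed.

Lemma induced_connect_mem U x y : connect (induced E U) x y -> (x \in U) = (y \in U).
Proof.
case/connectP=> p; elim: p x => [|z p IHp] x /=; first by move=> _ ->.
by case/andP=> /and3P[xU zU _] pp yE; rewrite xU -(IHp z) // zU.
Qed.

Lemma induced_root_mem U x : (rt U x \in U) = (x \in U).
Proof. by rewrite (induced_connect_mem (connect_root _ x)). Qed.

Lemma induced_rootP U x y : (rt U x == rt U y) = connect (induced E U) x y.
Proof. exact/root_connect/induced_connect_sym. Qed.

Lemma induced_root_root U x : rt U (rt U x) = rt U x.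
Proof. exact/root_root/induced_connect_sym. Qed.

Lemma ncomp_inducedE U : ncomp_induced E U = #|[set x in U | rt U x == x]|.
Proof. by apply: eq_card => x; rewrite !finset.inE andbC. Qed.

Lemma ncomp_induced_connected : (0 < #|V|)%N -> connected_graph E ->
  ncomp_induced E [set: V] = 1%N.
Proof.
case/card_gt0P=> x0 _ Econn; rewrite ncomp_inducedE -(cards1 (rt [set: V] x0)).
have all x y : connect (induced E [set: V]) x y.
  by rewrite (eq_connect (_ : _ =2 E)) // => z w; rewrite /induced /= !finset.inE.
congr #|pred_of_set _|; apply/setP => x; rewrite !finset.inE /=.
apply/eqP/eqP => [<-|->]; first by apply/eqP; rewrite induced_rootP.
exact: induced_root_root.
Qed.

Lemma induced_connectS U U' x y : U \subset U' ->
  connect (induced E U) x y -> connect (induced E U') x y.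
Proof.
move=> sUU'; apply: connect_sub => z w /and3P[zU wU Ezw]; apply: connect1.
by rewrite /induced /= Ezw !(fintype.subsetP sUU').
Qed.

(** Roots for [U] map onto the roots for [t |: U], and still do so when the root of [k] is dropped,
    since [t] joins [k] to [l]. *)
Lemma ncomp_merge U t k l : t \notin U -> k \in U -> l \in U -> E t k -> E t l ->
  ~~ connect (induced E U) k l -> (ncomp_induced E (t |: U) < ncomp_induced E U)%N.
Proof.
move=> tU kU lU tk tl nkl; rewrite !ncomp_inducedE.
set A := [set x in U | _]; set A' := [set x in _ | _].
have sU : U \subset t |: U by apply: finset.subsetUr.
have rtU x : x \in U -> rt U x \in A.
  by move=> xU; rewrite finset.inE induced_root_mem xU induced_root_root eqxx.
have rtU' x : rt (t |: U) (rt U x) = rt (t |: U) x.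
  apply/eqP; rewrite induced_rootP induced_connect_sym.
  exact/(induced_connectS sU)/connect_root.
have adj x : x \in U -> E t x -> rt (t |: U) x = rt (t |: U) t.
  move=> xU Etx; apply/eqP; rewrite induced_rootP; apply: connect1.
  by rewrite /induced /= !finset.inE xU eqxx orbT Esym.
have rkl : rt U l != rt U k by rewrite induced_rootP induced_connect_sym.
have sub : A' \subset [set rt (t |: U) x | x in A :\ rt U k].
  apply/fintype.subsetP => z; rewrite !finset.inE => /andP[/orP[/eqP->|zU] /eqP rz].
    apply/imsetP; exists (rt U l); rewrite ?rtU' ?adj // finset.in_setD1 rkl.
    exact: rtU.
  have [e|ne] := eqVneq (rt U z) (rt U k).
    apply/imsetP; exists (rt U l); first by rewrite finset.in_setD1 rkl rtU.
    by rewrite rtU' adj // -(adj k) // -rtU' -e rtU'.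
  by apply/imsetP; exists (rt U z); rewrite ?rtU' // finset.in_setD1 ne rtU.
apply: leq_ltn_trans (subset_leq_card sub) _.
apply: leq_ltn_trans (leq_imset_card _ _) _.
by rewrite [X in (_ < X)%N](cardsD1 (rt U k)) rtU.
Qed.

(** [rho] moves [t] to a neighbour in [U]. All such neighbours are connected within [U], so paths
    through [t] can be rerouted. The default [t] serves when no edge joins [t] to [U]. *)
Lemma induced_retract U t :
  (forall k l, k \in U -> l \in U -> E t k -> E t l -> connect (induced E U) k l) ->
  t \notin U ->
  exists rho : V -> V, (forall x, x \in U -> rho x = x) /\
    forall x y, connect (induced E (t |: U)) x y -> connect (induced E U) (rho x) (rho y).
Proof.
move=> adj tU; pose k0 := odflt t [pick k in U | E t k].
have k0P y : y \in U -> E t y -> connect (induced E U) k0 y.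
  move=> yU ty; rewrite /k0; case: pickP => [k /andP[kU tk]|/(_ y)] /=; first exact: adj.
  by rewrite yU ty.
exists (fun x => if x == t then k0 else x); split.
  by move=> x xU; case: eqP => // xt; rewrite -xt xU in tU.
move=> x y /connectP[p]; elim: p x => [|z p IHp] x /=; first by move=> _ ->; rewrite connect0.
case/andP=> /and3P[xU zU xz] pp yE; apply: connect_trans (IHp z pp yE).
move: xU zU; rewrite !finset.inE.
case: (eqVneq x t) xz => [->|_] xz /=; case: (eqVneq z t) xz => [->|_] xz //= xU zU.
- exact: k0P.
- by rewrite induced_connect_sym k0P // Esym.
- by apply: connect1; rewrite /induced /= xU zU.
Qed.

(** Otherwise the retraction keeps distinct components of the complement of [T] distinct after [t]
    is added, and their number does not drop. *)
Lemma cut_point_property_adj T t : cut_point_property E T -> t \in T ->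
  exists k l, [/\ k \in ~: T, l \in ~: T, E t k, E t l & rt (~: T) k != rt (~: T) l].
Proof.
move=> cutT tT; have := cutT t tT; apply: contraPP => nokl; apply/negP.
have tU : t \notin ~: T by rewrite finset.inE negbK.
have [|rho [rhoU rhoC]] := @induced_retract (~: T) t _ tU.
  move=> k l kU lU tk tl; rewrite -induced_rootP; apply: contrapT => /negP nkl.
  by apply: nokl; exists k, l.
rewrite -leqNgt !ncomp_inducedE; set U := ~: T in tU rhoU rhoC *.
set A := [set x in U | _]; set A' := [set x in _ | _].
have inj : {in A &, injective (rt (t |: U))}.
  move=> x y; rewrite !finset.inE => /andP[xU /eqP xr] /andP[yU /eqP yr] /eqP.
  rewrite induced_rootP => /rhoC; rewrite !rhoU ?finset.inE // -induced_rootP => /eqP.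
  by rewrite xr yr.
rewrite -(card_in_imset inj); apply/subset_leq_card/fintype.subsetP => _ /imsetP[x xA ->].
move: xA; rewrite finset.inE => /andP[xU _].
by rewrite finset.inE induced_root_mem induced_root_root eqxx finset.inE xU orbT.
Qed.

Lemma not_cut_point_property T : ~ cut_point_property E T ->
  exists2 t, t \in T & forall k l, k \in ~: T -> l \in ~: T -> E t k -> E t l ->
    connect (induced E (~: T)) k l.
Proof.
move=> ncut; apply: contrapT => not; apply: ncut => t tT.
apply: contrapT => nlt; apply: not; exists t => // k l kU lU tk tl.
apply: contrapT => /negP nkl; apply: nlt.
by apply: (ncomp_merge _ kU lU) => //; rewrite finset.inE negbK.
Qed.

(* A smallest set separating two non-adjacent vertices. *)
Lemma not_complete_cut : connected_graph E -> ~ complete_graph E ->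
  exists S, [/\ cut_point_property E S, S != finset.set0 & (#|S|.+2 <= #|V|)%N].
Proof.
move=> Econn ncomp.
have [i [j [ij nE]]] : exists i j, i != j /\ ~~ E i j.
  apply: contrapT => no; apply: ncomp => i j ij; apply: contrapT => /negP nE.
  by apply: no; exists i, j.
pose sep S := [&& i \notin S, j \notin S & ~~ connect (induced E (~: S)) i j].
(* All other vertices together separate the non-adjacent [i] and [j], so a minimum exists and has at
   most [#|V| - 2] elements. *)
have sep0 : sep (~: [set i; j]).
  rewrite /sep !finset.inE !eqxx !orbT /= finset.setCK; apply/negP => /connectP[p].
  case: p => [_ /= ji|z p /= /andP[/and3P[_ zU iz] pp] jE].
    by rewrite ji eqxx in ij.
  move: zU; rewrite !finset.inE => /orP[/eqP zi|/eqP zj]; last by rewrite -zj iz in nE.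
  move: jE pp; rewrite zi; elim: p => [/= ji|w p IHp /= jE /andP[/and3P[_ wU iw] pp]].
    by rewrite ji eqxx in ij.
  move: wU; rewrite !finset.inE => /orP[/eqP wi|/eqP wj]; last by rewrite -wj iw in nE.
  by rewrite wi in jE pp; apply: IHp.
case: (arg_minnP (fun S => #|S|) sep0) => S /and3P[iS jS nij] minS.
exists S; split.
- move=> s sS.
  (* By minimality [i] and [j] become connected when [s] is put back. If [s] merged no components,
     the retraction would connect them without [s]. *)
  have con : connect (induced E (s |: ~: S)) i j.
    have CS : s |: ~: S = ~: (S :\ s) by rewrite finset.setCD finset.setUC.
    rewrite CS; apply: contrapT => /negP ns.
    have := minS (S :\ s); rewrite /sep !finset.inE (negbTE iS) (negbTE jS) !andbF ns.
    by move=> /(_ isT); rewrite [X in (X <= _)%N](cardsD1 s) sS add1n ltnn.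
  apply: contrapT => nlt; move/negP: nij; apply.
  have adj k l : k \in ~: S -> l \in ~: S -> E s k -> E s l -> connect (induced E (~: S)) k l.
    move=> kU lU sk sl; apply: contrapT => /negP nkl; apply: nlt.
    by apply: (ncomp_merge _ kU lU) => //; rewrite finset.inE negbK.
  have [|rho [rhoU rhoC]] := induced_retract adj; first by rewrite finset.inE negbK.
  by have := rhoC _ _ con; rewrite !rhoU // finset.inE.
- apply: contraNneq nij => S0; rewrite S0 finset.setC0.
  by rewrite (eq_connect (_ : _ =2 E)) // => z w; rewrite /induced /= !finset.inE.
- have := minS _ sep0; rewrite -(cardsC [set i; j]) cards2 ij.
  by move=> h; rewrite -addn2 addnC leq_add2l.
Qed.

End InducedSubgraphs.

(** * Ideals generated by the minors of a pair of graphs *)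

(** The product of the individual multipliers works; it stays outside [P] because [P] is prime. *)
Lemma common_multiplier (R : comNzRingType) (J P : set R)
    (I : finType) (p : pred I) (F : I -> R) :
  is_ideal J -> prime_ideal P -> (forall i, p i -> exists2 s, ~ P s & J (s * F i)) ->
  exists2 s, ~ P s & forall i, p i -> J (s * F i).
Proof.
move=> Jid Pprime sF; have /prime_idealE[_ P1 _] := Pprime.
have [s sP] : exists s : I -> R, forall i, ~ P (s i) /\ (p i -> J (s i * F i)).
  have : forall i, exists s, ~ P s /\ (p i -> J (s * F i)).
    by move=> i; case: (boolP (p i)) => [/sF[s nPs Js]|_]; [exists s|exists 1].
  by case/choice=> s sP; exists s.
exists (\prod_i s i).
  by case/(prime_ideal_prod Pprime) => i _; case: (sP i).
move=> i pi; rewrite (bigD1 i) //= mulrAC mulrC; apply: (ideal_mull _ Jid).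
by case: (sP i) => _; apply.
Qed.

Section PairIdeal.
Variables (K : fieldType) (N m n : nat).
Variables (v : 'I_m -> 'I_n -> 'I_N) (row : 'I_N -> 'I_m) (col : 'I_N -> 'I_n).
Hypotheses (vrow : forall i k, row (v i k) = i) (vcol : forall i k, col (v i k) = k).
Hypothesis (rowcolK : forall a, v (row a) (col a) = a).
Local Notation x i k := ('X_(v i k) : {mpoly K[N]}).
Local Notation minor i j k l :=
  ('X_(v i k) * 'X_(v j l) - 'X_(v i l) * 'X_(v j k) : {mpoly K[N]}).
Variables (G1 : rel 'I_m) (G2 : rel 'I_n).
Hypotheses (G2_sym : symmetric G2).
Hypotheses (G1_conn : connected_graph G1) (G2_conn : connected_graph G2).
Hypothesis (m_gt1 : (1 < m)%N).
(* J is given by its universal property and the variables by a bijection v, so that rows and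
   columns can be exchanged. *)
Variable J : set {mpoly K[N]}.
Hypothesis Jid : is_ideal J.
Hypothesis Jminor : forall i j k l, G1 i j -> G2 k l -> J (minor i j k l).
Hypothesis Jleast : forall I : set {mpoly K[N]}, is_ideal I ->
  (forall i j k l, G1 i j -> G2 k l -> I (minor i j k l)) -> (J `<=` I)%classic.

Let r (T : {set 'I_n}) := fingraph.root (induced G2 (~: T)).
(** The prime P_T, each component of G_2 - T being represented by its root. *)
Let comp_ideal T := toric_ideal (K := K) v row col T (r T).
Let phi T := toric_img K v row col T (r T).

Let rT (T : {set 'I_n}) k : (r T k \in T) = (k \in T).
Proof.
by have := induced_root_mem G2 (~: T) k; rewrite !finset.in_setC => /negb_inj.
Qed.

Let rr T k : r T (r T k) = r T k.
Proof. exact: induced_root_root. Qed.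

Let comp_ideal_prime T : prime_ideal (comp_ideal T).
Proof. exact: toric_ideal_prime. Qed.

Let phi_x (T : {set 'I_n}) i k : msubst (phi T) (x i k) =
  if k \in T then 0 else toric_s K n (v i (r T k)) * toric_t K N k.
Proof. by rewrite msubstXU /phi /toric_img vrow vcol. Qed.

Lemma comp_ideal_minor (T : {set 'I_n}) i j k l :
  [|| k \in T, l \in T | r T k == r T l] -> comp_ideal T (minor i j k l).
Proof.
move=> kl; rewrite /comp_ideal /toric_ideal /= -/(phi T) msubst_minor !phi_x.
have [kT|kT] := boolP (k \in T); first by rewrite mul0r mulr0 subrr.
have [lT|lT] := boolP (l \in T); first by rewrite mul0r mulr0 subrr.
move: kl; rewrite (negbTE kT) (negbTE lT) /= => /eqP ->.
by rewrite mulrACA [X in _ - X]mulrACA [toric_t _ _ k * _]mulrC subrr.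
Qed.

Lemma sub_comp_ideal T : (J `<=` comp_ideal T)%classic.
Proof.
apply: Jleast; first by case/prime_idealE: (comp_ideal_prime T).
move=> i j k l _ kl; apply: comp_ideal_minor.
have [|kT] := boolP (k \in T) => //; have [|lT] := boolP (l \in T) => //=.
by rewrite induced_rootP // connect1 // /induced /= !finset.inE kT lT.
Qed.

Lemma comp_idealN_x (T : {set 'I_n}) i k : k \notin T -> ~ comp_ideal T (x i k).
Proof.
move=> kT; rewrite /comp_ideal /toric_ideal /= -/(phi T) phi_x (negbTE kT).
move/(congr1 (meval (fun=> 1))); rewrite mevalM !mevalXU mulr1 meval0.
by move/eqP; rewrite oner_eq0.
Qed.

Lemma comp_idealN_minor (T : {set 'I_n}) i j k l :
  i != j -> k \notin T -> l \notin T -> r T k != r T l ->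
  ~ comp_ideal T (minor i j k l).
Proof.
move=> ij kT lT kl; rewrite /comp_ideal /toric_ideal /= -/(phi T) msubst_minor !phi_x.
rewrite (negbTE kT) (negbTE lT).
(* Setting s_(i, r l) to 0 and all other variables to 1 kills only the second product, leaving the
   value 1. *)
move/(congr1 (meval (fun z => (z != lshift n (v i (r T l)))%:R))).
have neq i' k' : (v i' k' == v i (r T l)) = (i' == i) && (k' == r T l).
  apply/eqP/andP => [e|[/eqP-> /eqP->] //].
  by have := congr1 row e; have := congr1 col e; rewrite !vrow !vcol => -> ->.
rewrite mevalB !mevalM !mevalXU meval0 !eq_rlshift !(inj_eq (@lshift_inj _ _)) !neq.
rewrite (negbTE kl) [j == i]eq_sym (negbTE ij) !eqxx /= ?(mulr1n, mulr0n) !(mulr1, mul0r) subr0.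
by move/eqP; rewrite oner_eq0.
Qed.

(** * Localization at P_T and the associated primes it yields *)

Section Localization.
Variable T : {set 'I_n}.

(** The contraction to K[X] of the localization of [J] at P_T. *)
Definition localized : set {mpoly K[N]} :=
  [set g | exists2 s, ~ comp_ideal T s & J (s * g)]%classic.

Let comp_ideal_mul s t : ~ comp_ideal T s -> ~ comp_ideal T t -> ~ comp_ideal T (s * t).
Proof. by move=> ns nt; have /prime_idealE[_ _ PM] := comp_ideal_prime T; case/PM. Qed.

Let localized_ideal : is_ideal localized.
Proof.
split; first by exists 1; [case/prime_idealE: (comp_ideal_prime T)|rewrite mulr0; case: Jid].
move=> a g h [s ns Jg] [t nt Jh]; exists (s * t); first exact: comp_ideal_mul.
have -> : s * t * (a * g + h) = (t * a) * (s * g) + s * (t * h) by ring.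
by apply: (ideal_add Jid); apply: (ideal_mull _ Jid).
Qed.

Let localized_sub g : J g -> localized g.
Proof.
move=> Jg; exists 1; first by case/prime_idealE: (comp_ideal_prime T).
by rewrite mul1r.
Qed.

Let localized_cancel s g : ~ comp_ideal T s -> localized (s * g) -> localized g.
Proof.
move=> ns [t nt Jg]; exists (t * s); first exact: comp_ideal_mul.
by rewrite -mulrA.
Qed.

(** Along a path of rows in [G1], a three-term identity passes from consecutive rows to the end
    rows; its factor x_(i1, l) cancels because [l] is outside [T]. *)
Let minor_rows k l : l \notin T ->
  (forall i j, G1 i j -> localized (minor i j k l)) -> forall i j, localized (minor i j k l).
Proof.
move=> lT edge i j; have /connectP[p] := G1_conn i j.
elim: p i => [|i1 p IHp] i /=; first by move=> _ ->; rewrite mulrC subrr; case: localized_ideal.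
case/andP=> ii1 pp pj; apply: (localized_cancel (@comp_idealN_x T i1 l lT)).
have -> : x i1 l * minor i j k l = x j l * minor i i1 k l + x i l * minor i1 j k l by ring.
apply: (ideal_add localized_ideal); apply: (ideal_mull _ localized_ideal).
  exact: edge.
exact: IHp.
Qed.

(** After reduction to adjacent rows, the same device runs along a path of columns in G_2 - T,
    cancelling x_(j, k1). *)
Lemma localized_minor k l i j : k \notin T -> l \notin T -> r T k = r T l ->
  localized (minor i j k l).
Proof.
move=> kT lT /eqP; rewrite induced_rootP // => /connectP[p pp pl].
apply: minor_rows => // {}i {}j ij.
elim: p k kT pp pl => [|k1 p IHp] k kT /=.
  by move=> _ ->; rewrite subrr; case: localized_ideal.
case/andP=> /and3P[_]; rewrite finset.inE => k1T kk1 pp pl.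
apply: (localized_cancel (@comp_idealN_x T j k1 k1T)).
have -> : x j k1 * minor i j k l = x j l * minor i j k k1 + x j k * minor i j k1 l by ring.
apply: (ideal_add localized_ideal); apply: (ideal_mull _ localized_ideal).
  exact/localized_sub/Jminor.
exact: IHp.
Qed.

(** [t] has neighbours [k], [l] in different components, so the minor on columns [k], [l] is outside
    P_T. Its product with x_(i, t) is a combination of the minors on the edges t - l and t - k. *)
Lemma localized_x i t : cut_point_property G2 T -> t \in T -> localized (x i t).
Proof.
move=> cutT tT; have [k [l [kU lU tk tl rkl]]] := cut_point_property_adj G2_sym cutT tT.
rewrite !finset.inE in kU lU.
have [j ij] : exists j, i != j.
  have [j] : exists j, j \in [set~ i].
    by apply/card_gt0P; rewrite cardsC1 card_ord -subn1 subn_gt0.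
  by rewrite !finset.inE eq_sym; exists j.
have nP : ~ comp_ideal T (minor i j k l) by apply: comp_idealN_minor.
apply: (localized_cancel nP).
have -> : minor i j k l * x i t = x i k * minor i j t l + (- x i l) * minor i j t k by ring.
apply: (ideal_add localized_ideal); apply: (ideal_mull _ localized_ideal);
  apply: minor_rows => // i' j' ij'; exact/localized_sub/Jminor.
Qed.

End Localization.

(** The reduction of leading monomials is applied to [T] alone: a monomial meeting [T] is a multiple
    of some x_(i, t), any other is moved by swaps inside the components. *)
Lemma comp_ideal_generated (T : {set 'I_n}) (I : set {mpoly K[N]}) :
  is_ideal I -> (I `<=` comp_ideal T)%classic ->
  (forall i t, t \in T -> I (x i t)) ->
  (forall i j k l, k \notin T -> l \notin T -> r T k = r T l -> I (minor i j k l)) ->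
  (comp_ideal T `<=` I)%classic.
Proof.
move=> Iid IP Ix Iminor g Pg.
apply: (@toric_inter_sub K N m n v row col vcol rowcolK (eq T) r I Iid) => [_ <- //||_ <- //].
move=> u; have [dis|] := boolP [disjoint T & col_supp col u].
  right; exists T; split=> // u' dis' eqmon.
  apply: (@swap_closed_monomials K N m n v row col vrow vcol rowcolK
    I (r T) (col_supp col u) u u') => //.
  - apply: swap_closed_of_minors => // i j k l rkl kW lW.
    by apply: Iminor => //; [rewrite (disjointFl dis kW)|rewrite (disjointFl dis lW)].
  - by move=> k; rewrite -!(toric_mnm_col v row col (r T)) eqmon.
  - by move=> i d; rewrite -!(toric_mnm_row vrow vcol (r T)) eqmon.
case/pred0Pn=> t /andP[/= tT]; rewrite (col_suppE vcol rowcolK) => /existsP[i ui].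
left; rewrite -(submK (m' := u) (m := U_(v i t)%MM)) ?lep1mP // mpolyXD.
exact/(ideal_mull _ Iid)/Ix.
Qed.

(** [f1] multiplies the variables in columns of [T] into [J], [f2] the minors inside components, so
    J : f1 f2 contains P_T. Equality holds because [f1 * f2] is outside the prime P_T, which
    contains [J]. *)
Lemma comp_ideal_associated T : cut_point_property G2 T -> associated_prime J (comp_ideal T).
Proof.
move=> cutT; split; first exact: comp_ideal_prime.
have /prime_idealE[Pid P1 PM] := comp_ideal_prime T.
have [f1 nf1 Jf1] := @common_multiplier _ J (comp_ideal T) _ (fun it : 'I_m * 'I_n => it.2 \in T)
  (fun it => x it.1 it.2) Jid (comp_ideal_prime T) (fun it tT => localized_x it.1 cutT tT).
have [f2 nf2 Jf2] := @common_multiplier _ J (comp_ideal T) _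
  (fun z : 'I_m * 'I_m * ('I_n * 'I_n) =>
     [&& z.2.1 \notin T, z.2.2 \notin T & r T z.2.1 == r T z.2.2])
  (fun z => minor z.1.1 z.1.2 z.2.1 z.2.2) Jid (comp_ideal_prime T)
  (fun z h => let: And3 h1 h2 h3 := and3P h in localized_minor z.1.1 z.1.2 h1 h2 (eqP h3)).
exists (f1 * f2).
have nf : ~ comp_ideal T (f1 * f2) by case/PM.
apply/seteqP; split; last first.
  by move=> g /= /(@sub_comp_ideal T)/PM[].
apply: comp_ideal_generated.
- split=> [|a g h] /=; first by rewrite mul0r; case: Jid.
  by move=> Jg Jh; rewrite mulrDl -mulrA; case: Jid => _; apply.
- by move=> g /= /(@sub_comp_ideal T)/PM[].
- move=> i t tT /=; rewrite mulrA mulrC [_ * f1]mulrC; apply: (ideal_mull _ Jid).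
  exact: (Jf1 (i, t)).
- move=> i j k l kT lT rkl /=; rewrite mulrC -mulrA; apply: (ideal_mull _ Jid).
  by apply: (Jf2 ((i, j), (k, l))); rewrite /= kT lT rkl eqxx.
Qed.

(** * Heights of the primes P_T *)

Definition comp_ideal_ht (T : {set 'I_n}) : nat :=
  (m * #|T| + m.-1 * #|[set k in ~: T | r T k != k]|)%N.

Lemma comp_ideal_height T : has_height (comp_ideal T) (comp_ideal_ht T).
Proof.
pose i0 : 'I_m := Ordinal (ltnW m_gt1).
rewrite /comp_ideal_ht -(card_toric_dep vrow vcol rowcolK T (r T) i0).
exact: toric_ideal_height.
Qed.

Lemma card_nonroots T :
  (#|[set k in ~: T | r T k != k]| + ncomp_induced G2 (~: T) + #|T| = n)%N.
Proof.
have nT := cardsC T; rewrite card_ord in nT.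
have := cardsID [set k | r T k == k] (~: T).
have -> : ~: T :&: [set k | r T k == k] = [set k in ~: T | r T k == k].
  by apply/setP => k; rewrite !finset.inE.
have -> : ~: T :\: [set k | r T k == k] = [set k in ~: T | r T k != k].
  by apply/setP => k; rewrite !finset.inE andbC.
move=> h; rewrite ncomp_inducedE; apply: etrans nT; rewrite -h addnC; congr (_ + _)%N; exact: addnC.
Qed.

Lemma ncomp_set0 : (0 < n)%N -> ncomp_induced G2 (~: finset.set0) = 1%N.
Proof.
by move=> n0; rewrite finset.setC0 ncomp_induced_connected // card_ord.
Qed.

(** The height simplifies to |T| + (m-1)(n - c(T)), which is (m-1)(n-1) for the empty set. *)
Lemma comp_ideal_ht_eq T : (0 < n)%N -> comp_ideal_ht T = comp_ideal_ht finset.set0 <->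
  (((ncomp_induced G2 (~: T))%:Z - 1) * (m%:Z - 1) = #|T|%:Z :> int).
Proof.
move=> n0; rewrite /comp_ideal_ht; have := card_nonroots T; have := card_nonroots finset.set0.
rewrite ncomp_set0 // cards0 !addn0 muln0 add0n.
set q0 := #|[set k in ~: finset.set0 | _]|; set q := #|[set k in ~: T | _]|.
move: q0 q #|T| (ncomp_induced _ _) => q0 q t c e0 eT.
have {e0 eT}e : (q + c + t = q0.+1)%N by rewrite eT -e0 addn1.
by case: (m) m_gt1 => // a _ /=; split; nia.
Qed.

(** The empty set also has the cut point property, so P_T must have the height of its prime. *)
Lemma unmixed_cut T : (0 < n)%N -> unmixed J -> cut_point_property G2 T ->
  (((ncomp_induced G2 (~: T))%:Z - 1) * (m%:Z - 1) = #|T|%:Z :> int).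
Proof.
move=> n0 [h hP] cutT; apply/comp_ideal_ht_eq => //.
have /comp_ideal_associated/hP h0 : cut_point_property G2 finset.set0.
  by move=> t; rewrite finset.inE.
have hT := hP _ (comp_ideal_associated cutT).
by rewrite (has_height_uniq (comp_ideal_height T) hT) (has_height_uniq (comp_ideal_height _) h0).
Qed.

(** * The intersection of the primes P_T and the associated primes of [J] *)

Lemma comp_ideal_sub_cut T :
  exists2 T', cut_point_property G2 T' & (comp_ideal T' `<=` comp_ideal T)%classic.
Proof.
have [s] := ubnP #|T|; elim: s T => // s IHs T leT.
have [cutT|/(not_cut_point_property G2_sym)[t tT adj]] := pselect (cut_point_property G2 T).
  by exists T.
have CT : ~: (T :\ t) = t |: ~: T by rewrite finset.setCD finset.setUC.
(* Dropping a [t] whose neighbours outside [T] lie in one component makes the prime smaller or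
   leaves it equal, so induction on the size of [T] applies. *)
have [|T' cutT' sT'] := IHs (T :\ t).
  by move: leT; rewrite (cardsD1 t) tT.
suff PTt : (comp_ideal (T :\ t) `<=` comp_ideal T)%classic.
  by exists T'; [exact: cutT'|move=> g /(sT' g)/(PTt g)].
move=> g {T' cutT' sT'}.
have [|rho [rhoU rhoC]] := induced_retract G2_sym adj; first by rewrite finset.inE negbK.
(* The toric map of [T] factors through that of [T :\ t]: [psi] kills t_k for [k] in [T] and moves
   representatives to roots for [T] by way of the retraction. *)
pose psi (z : 'I_(N + n)) : {mpoly K[N + n]} := match split z with
  | inl a => toric_s K n (v (row a) (r T (rho (col a))))
  | inr k => if k \in T then 0 else toric_t K N k end.
rewrite /comp_ideal /toric_ideal /= => g0.
suff -> : msubst (phi T) g = msubst psi (msubst (phi (T :\ t)) g).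
  by rewrite /phi g0 rmorph0.
apply: (@mpoly_rmorph_ext K _ _ (msubst _) (msubst psi \o msubst _)) => /=.
  by move=> c; rewrite !mmapC.
move=> a; rewrite -(rowcolK a); move: (row a) (col a) => i k; rewrite !phi_x.
have psiM p q : msubst psi (p * q) = msubst psi p * msubst psi q by exact: rmorphM.
have psit : msubst psi (toric_t K N k) = if k \in T then 0 else toric_t K N k.
  by rewrite msubstXU /psi -/(unsplit (inr k)) unsplitK.
have psis b : msubst psi (toric_s K n b) = toric_s K n (v (row b) (r T (rho (col b)))).
  by rewrite msubstXU /psi -/(unsplit (inl b)) unsplitK.
rewrite in_setD1; have [kT|kT] := boolP (k \in T).
  rewrite andbT; case: ifP => _; first by rewrite rmorph0.
  by rewrite psiM psit kT mulr0.
rewrite andbF psiM psit (negbTE kT) psis vrow vcol; congr (toric_s _ _ (v _ _) * _).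
apply/eqP; rewrite -{1}(rhoU k) ?finset.inE // induced_rootP //.
by apply: rhoC; rewrite -CT connect_root.
Qed.

Lemma inter_comp_ideal : complete_graph G1 -> forall g, (forall T, comp_ideal T g) -> J g.
Proof.
move=> G1c g Pg.
apply: (@toric_inter_sub K N m n v row col vcol rowcolK (fun=> True) r J Jid) => [T _||T _].
- exact: sub_comp_ideal.
(* For this choice of [T] the components are those of the graph induced on the columns of [u];
   completeness of [G1] supplies the minors for all pairs of rows. *)
- move=> u; right; exists (~: col_supp col u).
  have dis w : [disjoint ~: col_supp col u & col_supp col w] =
      (col_supp col w \subset col_supp col u).
    by rewrite disjoint_sym finset.disjoints_subset finset.setCK.
  split=> //; first by rewrite dis.
  move=> u' _ eqmon.
  apply: (@swap_closed_monomials K N m n v row col vrow vcol rowcolK J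
    (r (~: col_supp col u)) (col_supp col u) u u') => //.
  - rewrite /r finset.setCK; apply: (swap_closed_of_edges vcol rowcolK) => // i j k l kl.
    have [<-|ij] := eqVneq i j; first by rewrite mulrC subrr; case: Jid.
    by apply: Jminor => //; apply: G1c.
  - by move=> k; rewrite -!(toric_mnm_col v row col (r (~: col_supp col u))) eqmon.
  - by move=> i d; rewrite -!(toric_mnm_row vrow vcol (r (~: col_supp col u))) eqmon.
- exact: Pg.
Qed.

(** If [f] is not in P_T, then [P] lies in P_T, and if they differ some [g T] in P_T is outside [P];
    in the other cases [g T] is 1. The product of all [g T] times [f] lies in every P_T, hence in
    [J], so [P] contains the product, against primality. *)
Lemma associated_comp_ideal P : complete_graph G1 -> associated_prime J P ->
  exists2 T, cut_point_property G2 T & P = comp_ideal T.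
Proof.
move=> G1c [Pprime [f Pf]]; have /prime_idealE[Pid P1 PM] := Pprime.
apply: contrapT => noT.
have sub T : cut_point_property G2 T -> ~ comp_ideal T f -> exists2 g, comp_ideal T g & ~ P g.
  move=> cutT nf; apply: contrapT => nog; apply: noT; exists T => //.
  have /prime_idealE[_ _ PTM] := comp_ideal_prime T.
  apply/seteqP; split=> g; last by move=> Pg; apply: contrapT => nPg; apply: nog; exists g.
  by rewrite Pf /= => /(@sub_comp_ideal T)/PTM[].
have /choice[g gP] : forall T : {set 'I_n}, exists g : {mpoly K[N]}, ~ P g /\
    (cut_point_property G2 T -> comp_ideal T (g * f)).
  move=> T; have [cutT|ncut] := pselect (cut_point_property G2 T); last by exists 1.
  have /prime_idealE[PTid _ _] := comp_ideal_prime T.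
  have [Tf|nTf] := pselect (comp_ideal T f).
    by exists 1; split=> // _; apply: ideal_mull.
  have [g Tg nPg] := sub T cutT nTf; exists g; split=> // _.
  exact: ideal_mulr.
have : P (\prod_T g T).
  rewrite Pf /=; apply: inter_comp_ideal => // T; have [T' cutT' sT'] := comp_ideal_sub_cut T.
  apply: sT'; rewrite (bigD1 T') //= mulrAC; apply: ideal_mulr.
    by case/prime_idealE: (comp_ideal_prime T').
  by case: (gP T') => _; apply.
by case/(prime_ideal_prod Pprime) => T _; case: (gP T).
Qed.

Lemma cut_unmixed : (0 < n)%N -> complete_graph G1 ->
  (forall T, cut_point_property G2 T ->
    (((ncomp_induced G2 (~: T))%:Z - 1) * (m%:Z - 1) = #|T|%:Z :> int)) -> unmixed J.
Proof.
move=> n0 G1c cutE; exists (comp_ideal_ht finset.set0) => P /(associated_comp_ideal G1c)[T cutT ->].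
have <- : comp_ideal_ht T = comp_ideal_ht finset.set0 by apply/comp_ideal_ht_eq => //; apply: cutE.
exact: comp_ideal_height.
Qed.

End PairIdeal.

(** * Unmixedness of the binomial edge ideal of a pair of graphs *)

Theorem proposition4p1 (K : fieldType) (m n : nat)
    (hm : (3 <= m)%N) (hmn : (m <= n)%N)
    (G1 : rel 'I_m) (G2 : rel 'I_n)
    (G1_sym : symmetric G1) (G1_irr : irreflexive G1)
    (G2_sym : symmetric G2) (G2_irr : irreflexive G2)
    (G1_conn : connected_graph G1) (G2_conn : connected_graph G2) :
  unmixed (binomial_edge_ideal K G1 G2) <->
    complete_graph G1 /\
    forall T : {set 'I_n}, cut_point_property G2 T ->
      (((ncomp_induced G2 (~: T))%:Z - 1) * (m%:Z - 1) = #|T|%:Z :> int)%R.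
Proof.
pose v (i : 'I_m) (k : 'I_n) := mxvec_index i k.
pose rc (a : 'I_(m * n)) := enum_val (cast_ord (esym (mxvec_cast m n)) a).
have rcv i k : rc (v i k) = (i, k) by rewrite /rc /v /mxvec_index cast_ordK enum_rankK.
have vrc a : v (rc a).1 (rc a).2 = a.
  by rewrite /v /mxvec_index -surjective_pairing enum_valK cast_ordKV.
set J := binomial_edge_ideal K G1 G2.
have Jid : is_ideal J by apply: ideal_span_is_ideal.
have Jlt i j k l : G1 i j -> G2 k l -> (i < j)%N -> (k < l)%N -> J (minor2 K i j k l).
  by move=> ij kl lij lkl; apply: ideal_span_gen; exists i, j, k, l.
have Jleast I : is_ideal I -> (forall i j k l, G1 i j -> G2 k l ->
    I ('X_(v i k) * 'X_(v j l) - 'X_(v i l) * 'X_(v j k))) -> (J `<=` I)%classic.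
  move=> Iid Imin; apply: ideal_span_sub => // _ [i [j [k [l [_ _ ij kl ->]]]]].
  exact: Imin.
clearbody J.
(* The generators use ordered edges only; exchanging two rows or two columns changes the sign, and
   irreflexivity rules out equal indices. *)
have Jminor i j k l : G1 i j -> G2 k l -> J ('X_(v i k) * 'X_(v j l) - 'X_(v i l) * 'X_(v j k)).
  have E : 'X_(v i k) * 'X_(v j l) - 'X_(v i l) * 'X_(v j k) = minor2 K i j k l by [].
  move=> ij kl; rewrite E; have nij : i != j by apply: contraTneq ij => ->; rewrite G1_irr.
  have nkl : k != l by apply: contraTneq kl => ->; rewrite G2_irr.
  have [lij|lij|eij] := ltngtP i j; last by case/eqP: nij; apply: val_inj.
    have [lkl|lkl|ekl] := ltngtP k l; last by case/eqP: nkl; apply: val_inj.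
      exact: Jlt.
    have -> : minor2 K i j k l = - minor2 K i j l k by rewrite /minor2; ring.
    by apply: (ideal_opp Jid); apply: Jlt => //; rewrite G2_sym.
  have [lkl|lkl|ekl] := ltngtP k l; last by case/eqP: nkl; apply: val_inj.
    have -> : minor2 K i j k l = - minor2 K j i k l by rewrite /minor2; ring.
    by apply: (ideal_opp Jid); apply: Jlt => //; rewrite G1_sym.
  have -> : minor2 K i j k l = minor2 K j i l k by rewrite /minor2; ring.
  by apply: Jlt; rewrite // (G1_sym, G2_sym).
have m_gt1 : (1 < m)%N by lia.
have n_gt1 : (1 < n)%N by lia.
have vrow i k : (fst \o rc) (v i k) = i by rewrite /= rcv.
have vcol i k : (snd \o rc) (v i k) = k by rewrite /= rcv.
split=> [Junm|[G1c cutE]]; last first.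
  exact: (cut_unmixed vrow vcol vrc G2_sym G2_conn m_gt1 Jid Jminor Jleast (ltnW n_gt1) G1c cutE).
split=> [|T]; last first.
  exact: (unmixed_cut vrow vcol vrc G2_sym G1_conn G2_conn m_gt1 Jid Jminor Jleast
            (ltnW n_gt1) Junm).
apply: contrapT => nc.
have [S [cutS S0 leS]] := not_complete_cut G1_sym G1_conn nc.
(* Transposing the matrix lets [G1] take the part of the column graph, so the equation for cut sets
   applies to [S]. *)
pose v' (k : 'I_n) (i : 'I_m) := v i k.
have Jminor' k l i j : G2 k l -> G1 i j ->
    J ('X_(v' k i) * 'X_(v' l j) - 'X_(v' k j) * 'X_(v' l i)).
  by move=> kl ij; have := Jminor i j k l ij kl; rewrite /v' [X in _ - X]mulrC.
have Jleast' I : is_ideal I -> (forall k l i j, G2 k l -> G1 i j ->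
    I ('X_(v' k i) * 'X_(v' l j) - 'X_(v' k j) * 'X_(v' l i))) -> (J `<=` I)%classic.
  move=> Iid Imin; apply: Jleast => // i j k l ij kl.
  by have := Imin k l i j kl ij; rewrite /v' [X in _ - X]mulrC.
have := @unmixed_cut K (m * n) n m v' (snd \o rc) (fst \o rc) (fun k i => vcol i k)
  (fun k i => vrow i k) vrc G2 G1 G1_sym G2_conn G1_conn n_gt1 J Jid Jminor' Jleast'
  S (ltnW m_gt1) Junm cutS.
(* In (c(S) - 1)(n - 1) = |S| the left side is at most 0 for c(S) <= 1 and at least n - 1 otherwise,
   while 0 < |S| <= m - 2 < n - 1. *)
move: S0 leS; rewrite -card_gt0 card_ord.
move: #|S| (ncomp_induced _ _) => s c s0 les e.
by case: c => [|[|c]] in e *; nia.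
Qed.
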